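(* Let $\mathcal{M}_S$ be a $2$-way quasi-independence model, specified by a set $S\subset[a]\times[b]$, with associated $\mathcal{A}$-matrix $\mathcal{A}_S$ and bipartite graph $\mathcal{G}_S$. Let $\mathcal{M}_{S'}$ be the $3$-way quasi-independence model with $\mathcal{A}$-matrix $\Lambda'(\mathcal{A}_S)$, the modified Lawrence lift of $\mathcal{A}_S$. Then $\Lambda'(\mathcal{A}_S)$ is a coordinate toric fiber product if and only if $\mathcal{G}_S$ is a collection of stars such that the central vertex of each star corresponds to the same variable.
   Context: **Quasi-independence models.** For a set $T\subset[m_1]\times\dots\times[m_k]$ of $k$-tuples, the $k$-way quasi-independence model $\mathcal{M}_T$ is the intersection of the probability simplex in $\mathbb{R}^T$ with the image of the monomial map whose coordinate indexed by $(i_1,\dots,i_k)\in T$ is $\prod_{j=1}^k s^j_{i_j}$. Its $\mathcal{A}$-matrix is the $0/1$ exponent matrix of this map: its columns are indexed by $T$, its rows split into $k$ blocks (the $j$th block having rows indexed by $[m_j]$), and the column of $(i_1,\dots,i_k)$ has in the $j$th block a single $1$, in row $i_j$. **Matrix and graph for $k=2$.** For $S\subset[a]\times[b]$, write $\mathcal{A}$ (with $a$ rows) and $\mathcal{B}$ (with $b$ rows) for the first and second blocks of $\mathcal{A}_S$. $\mathcal{G}_S$ is the bipartite graph with vertex set the disjoint union of $[a]$ and $[b]$ and with an edge joining $i\in[a]$ and $j\in[b]$ if and only if $(i,j)\in S$. Vertices in $[a]$ correspond to the first variable and vertices in $[b]$ to the second. A star (star tree) with $k+1$ vertices is a tree with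 one central node and $k$ leaves. **Modified Lawrence lift.** With $n=\#S$, $\Lambda'(\mathcal{A}_S)$ is the matrix with $2n$ columns obtained by stacking vertically the three blocks $\begin{pmatrix}\mathcal{A}&0\\0&\mathcal{A}\end{pmatrix}$, $\begin{pmatrix}\mathcal{B}&0\\0&\mathcal{B}\end{pmatrix}$, $\begin{pmatrix}I_n&I_n\end{pmatrix}$. If $S=\{(a_1,b_1),\dots,(a_n,b_n)\}$, it is the $\mathcal{A}$-matrix of the $3$-way quasi-independence model of $S'=\{(a_t,b_t,t) : t\in[n]\}\cup\{(a_t+a,\,b_t+b,\,t) : t\in[n]\}$. **Coordinate toric fiber product (cTFP).** Given the index sets of two quasi-independence models and a chosen coordinate in each, their coordinate toric fiber product is the set of all tuples obtained by gluing a tuple of the first set to a tuple of the second set having the same value in the chosen coordinate (the shared coordinate being recorded once). A set $T$ of triples (equivalently, its $\mathcal{A}$-matrix) is a cTFP along coordinate $j\in\{1,2,3\}$ if, with $\{p,q\}=\{1,2,3\}\setminus\{j\}$, $T$ is obtained by gluing its projections to the coordinates $\{p,j\}$ and $\{j,q\}$ along coordinate $j$. Equivalently, whenever $s,t\in T$ have the same $j$th coordinate, the triple with $j$th coordinate $s_j=t_j$, $p$th coordinate $s_p$ and $q$th coordinate $t_q$ is also in $T$. $T$ is a cTFP if it is one along at least one coordinate.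
   Formalization: Isolated vertices of G_S are ignored: only components containing an edge must be stars with centers in the same variable; otherwise S={(1,1)} in [2]×[2], whose lift is a coordinate toric fiber product while G_S has isolated vertices on both sides, is a counterexample. *)

(* Defs.v *)
From HB Require Import structures.
From mathcomp Require Import all_boot all_order all_algebra.

Set Implicit Arguments.
Unset Strict Implicit.
Unset Printing Implicit Defensive.

Import GRing.Theory.

Local Open Scope ring_scope.

(* [u] is a repetition-free listing of [T]; it fixes an order of the columns
   of an A-matrix, which are indexed by [T]. *)
Definition lists (X : finType) (n : nat) (u : 'I_n -> X) (T : {set X}) : Prop :=
  injective u /\ T = [set u t | t : 'I_n].

Definition indicator_block (m n : nat) (f : 'I_n -> 'I_m) : 'M[int]_(m, n) :=
  \matrix_(i < m, t < n) (f t == i)%:R.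

Definition is_A_matrix2 (a b n : nat) (S : {set 'I_a * 'I_b})
    (M : 'M[int]_(a + b, n)) : Prop :=
  exists2 u : 'I_n -> 'I_a * 'I_b, lists u S &
    M = col_mx (indicator_block (fun t => (u t).1))
               (indicator_block (fun t => (u t).2)).

Definition is_A_matrix3 (a b c n : nat) (T : {set 'I_a * 'I_b * 'I_c})
    (M : 'M[int]_(a + b + c, n)) : Prop :=
  exists2 u : 'I_n -> 'I_a * 'I_b * 'I_c, lists u T &
    M = col_mx (col_mx (indicator_block (fun t => (u t).1.1))
                       (indicator_block (fun t => (u t).1.2)))
               (indicator_block (fun t => (u t).2)).

Definition modified_lawrence (a b n : nat) (M : 'M[int]_(a + b, n)) :
    'M[int]_((a + a) + (b + b) + n, n + n) :=
  let A := usubmx M in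
  let B := dsubmx M in
  col_mx (col_mx (block_mx A 0 0 A) (block_mx B 0 0 B)) (row_mx 1%:M 1%:M).

(* The index set S' of the lift; [is_A_matrix3_lawrence] shows that it has
   [modified_lawrence M] as an A-matrix whenever [M] is an A-matrix of S with
   columns listed by [u]. *)
Definition lawrence_set (a b n : nat) (u : 'I_n -> 'I_a * 'I_b) :
    {set 'I_(a + a) * 'I_(b + b) * 'I_n} :=
  [set (lshift a (u t).1, lshift b (u t).2, t) | t : 'I_n]
  :|: [set (rshift a (u t).1, rshift b (u t).2, t) | t : 'I_n].

Lemma is_A_matrix3_lawrence (a b n : nat) (u : 'I_n -> 'I_a * 'I_b) :
  is_A_matrix3 (lawrence_set u)
    (modified_lawrence (col_mx (indicator_block (fun t => (u t).1))
                               (indicator_block (fun t => (u t).2)))).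
Proof.
pose lo t := (lshift a (u t).1, lshift b (u t).2, t).
pose hi t := (rshift a (u t).1, rshift b (u t).2, t).
pose v (t : 'I_(n + n)) := match split t with inl s => lo s | inr s => hi s end.
have vl s : v (lshift n s) = lo s by rewrite /v (unsplitK (inl s)).
have vr s : v (rshift n s) = hi s by rewrite /v (unsplitK (inr s)).
exists v.
  split.
    move=> s t; case: (splitP s) => s' Es; case: (splitP t) => t' Et;
      [have -> : s = lshift n s' by exact: val_inj
      |have -> : s = lshift n s' by exact: val_inj
      |have -> : s = rshift n s' by exact: val_inj
      |have -> : s = rshift n s' by exact: val_inj];
      [have -> : t = lshift n t' by exact: val_inj
      |have -> : t = rshift n t' by exact: val_inj
      |have -> : t = lshift n t' by exact: val_inj
      |have -> : t = rshift n t' by exact: val_inj];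
      rewrite ?vl ?vr.
    - by move/(congr1 snd) => /= ->.
    - by move/(congr1 (fun w => w.1.1))/eqP; rewrite eq_lrshift.
    - by move/(congr1 (fun w => w.1.1))/eqP; rewrite eq_rlshift.
    - by move/(congr1 snd) => /= ->.
  apply/setP=> w; apply/setUP/imsetP.
    by case=> /imsetP[t _ ->]; [exists (lshift n t) | exists (rshift n t)];
      rewrite ?vl ?vr.
  case=> t _ ->; case: (split_ordP t) => s ->; rewrite ?vl ?vr;
    [left | right]; exact: imset_f.
rewrite /modified_lawrence col_mxKu col_mxKd.
congr (col_mx (col_mx _ _) _); apply/matrixP=> i t;
  case: (split_ordP t) => s -> {t}; rewrite !mxE ?vl ?vr.
all: try by (case: (split_ordP i) => j -> {i};
  rewrite ?unsplitK ?col_mxEu ?col_mxEd ?row_mxEl ?row_mxEr !mxE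
          ?eq_lshift ?eq_rshift ?eq_lrshift ?eq_rlshift).
all: by rewrite ?(unsplitK (inl s)) ?(unsplitK (inr s)) !mxE eq_sym.
Qed.

Definition glue (P J Q : finType) (L : {set P * J}) (R : {set J * Q}) :
    {set P * J * Q} :=
  [set (l.1, l.2, r.2) | l in L, r in R & l.2 == r.1].

(* Here [cp], [cj], [cq] are the three coordinate maps of [X], in some order:
   up to the order of its coordinates, T is the gluing of its projections
   along the coordinate [cj]. *)
Definition cTFP_along (X P J Q : finType) (cp : X -> P) (cj : X -> J)
    (cq : X -> Q) (T : {set X}) : Prop :=
  [set (cp t, cj t, cq t) | t in T]
  = glue [set (cp t, cj t) | t in T] [set (cj t, cq t) | t in T].

Definition is_cTFP (X1 X2 X3 : finType) (T : {set X1 * X2 * X3}) : Prop :=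
  let x1 (t : X1 * X2 * X3) := t.1.1 in
  let x2 (t : X1 * X2 * X3) := t.1.2 in
  let x3 (t : X1 * X2 * X3) := t.2 in
  [\/ cTFP_along x2 x1 x3 T, cTFP_along x1 x2 x3 T | cTFP_along x1 x3 x2 T].

Definition qi_graph (a b : nat) (S : {set 'I_a * 'I_b}) : rel ('I_a + 'I_b) :=
  fun v w => match v, w with
             | inl i, inr j => (i, j) \in S
             | inr j, inl i => (i, j) \in S
             | _, _ => false
             end.

Section Stars.

Variables (V : finType) (e : rel V).

Definition induced (C : {set V}) : rel V :=
  [rel x y | [&& x \in C, y \in C & e x y]].

Definition is_tree (C : {set V}) : Prop :=
  [/\ C != set0,
      {in C &, forall x y, connect (induced C) x y}
    & forall p : seq V, (2 < size p)%N -> ~ ucycle (induced C) p].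

Definition is_leaf (C : {set V}) (x : V) : Prop :=
  #|[set y | induced C x y]| = 1%N.

Definition is_star (C : {set V}) (c : V) : Prop :=
  [/\ is_tree C, c \in C & {in C, forall x, x != c -> is_leaf C x}].

Definition component (x : V) : {set V} := [set y | connect e x y].

(* Only components with at least one edge are constrained: an isolated vertex
   of the graph of S is an index that does not occur in S (a zero row of the
   A-matrix), and does not count as a star with its own central vertex.  In a
   component with a single edge either endpoint may be taken as the centre. *)
Definition stars_centered_in (K : {pred V}) : Prop :=
  forall x y, e x y -> exists2 c, c \in K & is_star (component x) c.

End Stars.

Definition first_variable (a b : nat) : {pred 'I_a + 'I_b} :=
  [pred v | if v is inl _ then true else false].

Definition second_variable (a b : nat) : {pred 'I_a + 'I_b} :=
  [pred v | if v is inr _ then true else false].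

Definition is_star_collection_same_variable (a b : nat)
    (e : rel ('I_a + 'I_b)) : Prop :=
  stars_centered_in e (@first_variable a b)
  \/ stars_centered_in e (@second_variable a b).

(* Main.v *)
Require Import Defs.
From mathcomp Require Import all_boot all_order all_algebra.

(** If two columns of [A_S] share their first coordinate [i], say [(i, j)] and
    [(i, j')] at positions [t] and [t'], then gluing the triples [(i, j, t)] and
    [(i, j', t')] of the lift along [i] gives [(i, j, t')], which is in the lift
    only if [j = j'].  So the lift is a cTFP along the first coordinate iff every
    vertex of [a] has degree at most one in [G_S], i.e. iff [G_S] consists of
    stars centred in [b]; symmetrically for the second coordinate.  Gluing along
    the third coordinate would produce triples mixing the two copies of S, so it
    works only for S empty. *)

Set Implicit Arguments.
Unset Strict Implicit.
Unset Printing Implicit Defensive.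

(** * Star components of a bipartite graph with sides [K] and its complement *)

Section BipartiteStars.

Variables (V : finType) (e : rel V) (K : {pred V}).
Hypothesis e_sym : symmetric e.
Hypothesis e_bip : forall x y, e x y -> (x \in K) = (y \notin K).

Definition degree_le1_outside : Prop :=
  forall x y z, x \notin K -> e x y -> e x z -> y = z.

(** A vertex outside [K] is not the centre of its star, hence it is a leaf and has a single
    neighbour. *)
Lemma stars_centered_degree_le1 :
  stars_centered_in e K -> degree_le1_outside.
Proof.
move=> stK x y z xNK exy exz.
have [c cK [_ _ leafs]] := stK x y exy.
have xC : x \in component e x by rewrite inE connect0.
have xc : x != c by apply: contraNneq xNK => ->.
have /eqP/cards1P[w Ew] := leafs x xC xc.
have in_w v : e x v -> v = w.
  move=> exv; apply/set1P; rewrite -Ew inE /induced /= xC exv inE andbT.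
  exact: connect1.
by rewrite (in_w y) // (in_w z).
Qed.

(* Of two consecutive vertices of a cycle one is outside [K], and its two
   neighbours on the cycle would coincide. *)
Lemma no_long_cycle (C : {set V}) (p : seq V) :
  degree_le1_outside -> (2 < size p)%N -> ~ ucycle (induced e C) p.
Proof.
move=> deg1; case: p => [|x [|y [|z q]]] // _ /andP[] /=.
move=> /and3P[/and3P[_ _ exy] /and3P[_ _ eyz] pz].
rewrite !inE !negb_or -!andbA => /and5P[xy xz _ yz /andP[yq _]].
have [yK|yNK] := boolP (y \in K); last first.
  by move/eqP: xz; apply; apply: (deg1 y); rewrite // e_sym.
have zNK : z \notin K by rewrite -(e_bip eyz).
have neq_y w : e z w -> w != y -> False.
  by move=> ezw /eqP; apply; apply: (deg1 z); rewrite // e_sym.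
(* The neighbour of [z] other than [y] on the cycle is [x] if the length is three, and the next
   vertex [w] otherwise. *)
case: q pz yq => [|w q] /=; first by case/andP=> /and3P[_ _ /neq_y] /(_ xy).
case/andP=> /and3P[_ _ /neq_y ezw] _; rewrite inE negb_or eq_sym.
by case/andP=> /ezw.
Qed.

(** A neighbour of [c] lies outside [K], so its only neighbour is [c]: no edge leaves the set on the
    right. *)
Lemma component_center (c : V) : degree_le1_outside -> c \in K ->
  component e c = [set y | (y == c) || e c y].
Proof.
move=> deg1 cK; apply/setP=> y; rewrite !inE; apply/idP/idP; last first.
  by case/orP=> [/eqP->|/connect1]; first exact: connect0.
suff clo : closed e [pred y | (y == c) || e c y].
  by move/(closed_connect clo); rewrite !inE eqxx /= => <-.
apply: (intro_closed (sym_connect_sym e_sym)) => v w evw.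
rewrite !inE => /predU1P[<-|ecv]; first by rewrite evw orbT.
rewrite (deg1 v w c) ?eqxx //; last by rewrite e_sym.
by rewrite -(e_bip ecv).
Qed.

(** Any two vertices are joined through [c], and a vertex other than [c] is outside [K] with [c] as
    its unique neighbour. *)
Lemma component_is_star (c : V) :
  degree_le1_outside -> c \in K -> is_star e (component e c) c.
Proof.
move=> deg1 cK; have EC := component_center deg1 cK.
set C := component e c in EC *.
have cC : c \in C by rewrite EC inE eqxx.
have C_cases x : x \in C -> x = c \/ e c x.
  by rewrite EC inE => /predU1P.
have eC x : e c x -> x \in C by rewrite EC inE orbC => ->.
have ind_sym : symmetric (induced e C).
  by move=> x y; rewrite /induced /= (e_sym x) andbCA.
have from_c x : x \in C -> connect (induced e C) c x.
  move=> xC; have [->|ecx] := C_cases x xC; first exact: connect0.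
  by apply: connect1; rewrite /induced /= cC xC.
split=> // [|x xC xc].
  split; first by apply/set0Pn; exists c.
    move=> x y xC yC; apply: connect_trans (from_c y yC).
    by rewrite (sym_connect_sym ind_sym) from_c.
  by move=> p; apply: no_long_cycle.
have [Exc|ecx] := C_cases x xC; first by rewrite Exc eqxx in xc.
have xNK : x \notin K by rewrite -(e_bip ecx).
apply/eqP/cards1P; exists c; apply/setP=> y; rewrite !inE /induced /=.
apply/idP/eqP=> [/and3P[_ _ exy]|->]; last by rewrite xC cC e_sym.
by apply: (deg1 x); rewrite // e_sym.
Qed.

Lemma stars_centeredP : stars_centered_in e K <-> degree_le1_outside.
Proof.
split=> [|deg1 x y exy]; first exact: stars_centered_degree_le1.
(* Exactly one endpoint of the edge is in [K]; it serves as the centre. *)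
have [xK|xNK] := boolP (x \in K); first by exists x; last exact: component_is_star.
have yK : y \in K by rewrite -[_ \in _]negbK -(e_bip exy).
exists y => //; suff -> : component e x = component e y by exact: component_is_star.
apply/setP=> z; rewrite !inE.
exact: (same_connect (sym_connect_sym e_sym) (connect1 exy)).
Qed.

End BipartiteStars.

(** * Star collections in the graph of [S] *)

Lemma qi_graph_sym (a b : nat) (S : {set 'I_a * 'I_b}) : symmetric (qi_graph S).
Proof. by case=> i [] j. Qed.

(** The degree bound on the vertices of [[a]] says that no two pairs of [S] share their first
    coordinate; [u] lists these pairs without repetition. *)
Lemma stars_in_second_variableP (a b n : nat) (u : 'I_n -> 'I_a * 'I_b)
    (S : {set 'I_a * 'I_b}) : lists u S ->
  stars_centered_in (qi_graph S) (@second_variable a b)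
    <-> injective (fun t => (u t).1).
Proof.
move=> [u_inj ->]; set G := qi_graph _.
have G_bip x y : G x y ->
  (x \in @second_variable a b) = (y \notin @second_variable a b).
  by case: x y => [i|i] [j|j].
apply: (iff_trans (stars_centeredP (@qi_graph_sym _ _ _) G_bip)).
split=> [deg1 s t Est|inj [i|i] // [j|j] // [k|k] // _].
  apply: u_inj; apply: injective_projections => //.
  suff [] : @inr 'I_a 'I_b (u s).2 = inr (u t).2 by [].
  apply: (deg1 (inl (u s).1)) => //=; last rewrite Est;
    by rewrite -surjective_pairing imset_f.
move=> /imsetP[s _ Es] /imsetP[t _ Et]; congr inr.
have Est : s = t by apply: inj; rewrite -Es -Et.
by move: Es; rewrite Est -Et => -[].
Qed.

Lemma stars_in_first_variableP (a b n : nat) (u : 'I_n -> 'I_a * 'I_b)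
    (S : {set 'I_a * 'I_b}) : lists u S ->
  stars_centered_in (qi_graph S) (@first_variable a b)
    <-> injective (fun t => (u t).2).
Proof.
move=> [u_inj ->]; set G := qi_graph _.
have G_bip x y : G x y ->
  (x \in @first_variable a b) = (y \notin @first_variable a b).
  by case: x y => [i|i] [j|j].
apply: (iff_trans (stars_centeredP (@qi_graph_sym _ _ _) G_bip)).
split=> [deg1 s t Est|inj [i|i] // [j|j] // [k|k] // _].
  apply: u_inj; apply: injective_projections => //.
  suff [] : @inl 'I_a 'I_b (u s).1 = inl (u t).1 by [].
  apply: (deg1 (inr (u s).2)) => //=; last rewrite Est;
    by rewrite -surjective_pairing imset_f.
move=> /imsetP[s _ Es] /imsetP[t _ Et]; congr inl.
have Est : s = t by apply: inj; rewrite -Es -Et.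
by move: Es; rewrite Est -Et => -[].
Qed.

(** * A-matrices determine index sets; criteria for gluing *)

Lemma indicator_block_inj (m n : nat) (f g : 'I_n -> 'I_m) :
  indicator_block f = indicator_block g -> f =1 g.
Proof.
move=> /matrixP E t; move: (E (f t) t); rewrite !mxE eqxx.
by case: eqP => // ->.
Qed.

(** The positions of the ones in a column give back its triple. This identifies [S'] with the
    explicit [lawrence_set]. *)
Lemma is_A_matrix3_inj (a b c n : nat) (T T' : {set 'I_a * 'I_b * 'I_c})
    (M : 'M[int]_(a + b + c, n)) :
  is_A_matrix3 T M -> is_A_matrix3 T' M -> T = T'.
Proof.
move=> [u [_ ->] ->] [v [_ ->]] /eq_col_mx[/eq_col_mx[E1 E2] E3].
apply: eq_imset => t.
rewrite (surjective_pairing (u t)) (surjective_pairing (u t).1).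
rewrite (indicator_block_inj E1) (indicator_block_inj E2).
by rewrite (indicator_block_inj E3) -!surjective_pairing.
Qed.

(** A set always lies in the gluing of its projections, so only the reverse inclusion is a
    condition. *)
Lemma cTFP_alongP (X P J Q : finType) (cp : X -> P) (cj : X -> J)
    (cq : X -> Q) (T : {set X}) :
  cTFP_along cp cj cq T <->
  (forall s t, s \in T -> t \in T -> cj s = cj t ->
     exists2 r, r \in T & [/\ cp r = cp s, cj r = cj s & cq r = cq t]).
Proof.
split=> [/setP E s t sT tT Est|glT].
  move: (E (cp s, cj s, cq t)).
  have -> : (cp s, cj s, cq t) \in
      glue [set (cp t, cj t) | t in T] [set (cj t, cq t) | t in T].
    apply/imset2P; exists (cp s, cj s) (cj t, cq t) => //; first exact: imset_f.
    by rewrite inE imset_f //= Est.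
  by case/imsetP=> r rT [-> -> ->]; exists r.
apply/setP=> w; apply/imsetP/imset2P=> [[t tT ->]|].
  exists (cp t, cj t) (cj t, cq t) => //; first exact: imset_f.
  by rewrite inE imset_f /=.
case=> _ r /imsetP[s sT ->]; rewrite inE => /andP[/imsetP[t tT ->]] /= /eqP Est ->.
by have [x xT [<- <- <-]] := glT s t sT tT Est; exists x.
Qed.

(** Each tuple can only be glued to itself. *)
Lemma cTFP_along_inj (X P J Q : finType) (cp : X -> P) (cj : X -> J)
    (cq : X -> Q) (T : {set X}) :
  {in T &, injective cj} -> cTFP_along cp cj cq T.
Proof.
by move=> inj; apply/cTFP_alongP=> s t sT tT /(inj s t sT tT) <-; exists s.
Qed.

(** * Gluing the lift along each coordinate *)

Section LawrenceSet.

Variables (a b n : nat) (u : 'I_n -> 'I_a * 'I_b).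
Hypothesis u_inj : injective u.

Let X : finType := ('I_(a + a) * 'I_(b + b) * 'I_n)%type.
Let lo t : X := (lshift a (u t).1, lshift b (u t).2, t).
Let hi t : X := (rshift a (u t).1, rshift b (u t).2, t).

Lemma lawrence_setP (w : X) :
  reflect (exists t, w = lo t \/ w = hi t) (w \in lawrence_set u).
Proof.
apply: (iffP setUP) => [[]/imsetP[t _ ->]|[t [->|->]]].
- by exists t; left.
- by exists t; right.
- by left; exact: imset_f.
- by right; exact: imset_f.
Qed.

Lemma lawrence_cTFP1 :
  cTFP_along (fun w : X => w.1.2) (fun w => w.1.1) (fun w => w.2) (lawrence_set u)
    <-> injective (fun t => (u t).1).
Proof.
split=> [/cTFP_alongP glT s t Est|inj].
  have [||/= |r] := glT (lo s) (lo t); try by apply/lawrence_setP; eexists; left.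
    by rewrite Est.
  (* The first coordinate puts the glued triple in the copy [lo], and the third makes it [lo t]; its
     second coordinate comes from [s]. *)
  case/lawrence_setP=> t' [->|->] /= [E2 E1 Et]; last first.
    by move/eqP: E1; rewrite eq_rlshift.
  apply: u_inj; apply: injective_projections => //; rewrite -Et.
  exact: (esym (lshift_inj E2)).
(* The two copies have disjoint first coordinates, so injectivity is checked within each copy. *)
apply: cTFP_along_inj => _ _ /lawrence_setP[s [->|->]] /lawrence_setP[t [->|->]] /=.
- by move/lshift_inj/inj->.
- by move/eqP; rewrite eq_lrshift.
- by move/eqP; rewrite eq_rlshift.
- by move/rshift_inj/inj->.
Qed.

Lemma lawrence_cTFP2 :
  cTFP_along (fun w : X => w.1.1) (fun w => w.1.2) (fun w => w.2) (lawrence_set u)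
    <-> injective (fun t => (u t).2).
Proof.
split=> [/cTFP_alongP glT s t Est|inj].
  have [||/= |r] := glT (lo s) (lo t); try by apply/lawrence_setP; eexists; left.
    by rewrite Est.
  case/lawrence_setP=> t' [->|->] /= [E1 E2 Et]; last first.
    by move/eqP: E2; rewrite eq_rlshift.
  apply: u_inj; apply: injective_projections => //; rewrite -Et.
  exact: (esym (lshift_inj E1)).
apply: cTFP_along_inj => _ _ /lawrence_setP[s [->|->]] /lawrence_setP[t [->|->]] /=.
- by move/lshift_inj/inj->.
- by move/eqP; rewrite eq_lrshift.
- by move/eqP; rewrite eq_rlshift.
- by move/rshift_inj/inj->.
Qed.

Lemma lawrence_cTFP3_empty :
  cTFP_along (fun w : X => w.1.1) (fun w => w.2) (fun w => w.1.2) (lawrence_set u)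
    -> 'I_n -> False.
Proof.
move=> /cTFP_alongP glT t.
(* The glued triple has its first coordinate in the lower range and its second in the upper one. *)
have [||//|r] := glT (lo t) (hi t); try by apply/lawrence_setP; exists t; auto.
case/lawrence_setP=> t' [->|->] /= [/eqP E1 _ /eqP].
  by rewrite eq_lrshift.
by rewrite eq_rlshift in E1.
Qed.

End LawrenceSet.

Theorem theorem5p4 (a b n : nat) (S : {set 'I_a * 'I_b})
    (A_S : 'M[int]_(a + b, n))
    (S' : {set 'I_(a + a) * 'I_(b + b) * 'I_n})
    (hS : is_A_matrix2 S A_S)
    (hS' : is_A_matrix3 S' (modified_lawrence A_S)) :
  is_cTFP S' <-> is_star_collection_same_variable (qi_graph S).
Proof.
have [u uS EA] := hS; have [u_inj _] := uS.
rewrite EA in hS'.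
rewrite (is_A_matrix3_inj hS' (is_A_matrix3_lawrence u)).
split=> [[T1|T2|T3]|[st1|st2]].
- by right; apply/(stars_in_second_variableP uS)/(lawrence_cTFP1 u_inj).
- by left; apply/(stars_in_first_variableP uS)/(lawrence_cTFP2 u_inj).
(* There are no columns here, so injectivity is vacuous and either side could be chosen. *)
- left; apply/(stars_in_first_variableP uS) => t.
  by case: (lawrence_cTFP3_empty T3 t).
- by apply: Or32; apply/(lawrence_cTFP2 u_inj)/(stars_in_first_variableP uS).
- by apply: Or31; apply/(lawrence_cTFP1 u_inj)/(stars_in_second_variableP uS).
Qed.
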